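(* Let $\Omega\subsetneq \mathbb{C}$ be a simply connected domain, $\gamma:\mathbb{R} \to \Omega$ a geodesic (for the hyperbolic distance $k_\Omega$) parameterized by hyperbolic arc length, $x_0\in \gamma(\mathbb{R})$ and $z\in \Omega$. Then $$k_\Omega(x_0, \pi_\gamma(z))+k_\Omega(z, \gamma)-\frac{1}{2}\log 2 \leq k_\Omega(x_0, z)\leq k_\Omega(x_0, \pi_\gamma(z))+k_\Omega(z, \gamma),$$ where $k_\Omega(z, \gamma):=\inf_{t\in \mathbb{R}}k_\Omega(z, \gamma(t))=k_\Omega(z,\pi_\gamma(z))$.
   Context: Let $\mathbb{D}=\{\zeta\in\mathbb{C}:|\zeta|<1\}$. The hyperbolic norm in $\mathbb{D}$ is $\kappa_{\mathbb{D}}(z;v)=\frac{|v|}{1-|z|^2}$ and the hyperbolic distance is $\omega(z,w)=\frac12\log\frac{1+|T_z(w)|}{1-|T_z(w)|}$ with $T_z(w)=\frac{z-w}{1-\overline{z}w}$. For a simply connected domain $\Omega\subsetneq\mathbb{C}$ with Riemann map $f:\mathbb{D}\to\Omega$, the hyperbolic norm $\kappa_\Omega(z;v)=\kappa_{\mathbb{D}}(f^{-1}(z);v/f'(f^{-1}(z)))$, the associated hyperbolic length of curves, and the hyperbolic distance $k_\Omega(z,w)=\omega(f^{-1}(z),f^{-1}(w))$ are obtained by transport through $f$ (independent of $f$). A geodesic is a smooth curve such that the hyperbolic length of the curve between any two of its points equals the hyperbolic distance between these two points. For a geodesic $\gamma:\mathbb{R}\to\Omega$ parameterized by arc length and $z\in\Omega$,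 the hyperbolic projection $\pi_\gamma(z)\in\gamma(\mathbb{R})$ is the (unique) point of $\gamma(\mathbb{R})$ closest to $z$: $k_\Omega(\pi_\gamma(z),z)=\min_{t\in\mathbb{R}}k_\Omega(\gamma(t),z)$. *)

(* Defs.v *)
From Stdlib Require Import Reals ClassicalEpsilon.
From Coquelicot Require Import Coquelicot.

Open Scope R_scope.

Definition disc (z : C) : Prop := Cmod z < 1.

Definition disc_norm (z v : C) : R := Cmod v / (1 - Cmod z ^ 2).

Definition disc_mobius (z w : C) : C := ((z - w) / (1 - Cconj z * w))%C.

Definition disc_dist (z w : C) : R :=
  / 2 * ln ((1 + Cmod (disc_mobius z w)) / (1 - Cmod (disc_mobius z w))).

Definition connected_set (Omega : C -> Prop) : Prop :=
  forall U V : C -> Prop,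
    open U -> open V ->
    (forall z, Omega z -> U z \/ V z) ->
    (exists z, Omega z /\ U z) -> (exists z, Omega z /\ V z) ->
    exists z, Omega z /\ U z /\ V z.

Definition domain (Omega : C -> Prop) : Prop :=
  open Omega /\ (exists z, Omega z) /\ connected_set Omega.

Definition unit_interval (s : R) : Prop := 0 <= s <= 1.

Definition unit_square (p : R * R) : Prop :=
  unit_interval (fst p) /\ unit_interval (snd p).

Definition loop_in (Omega : C -> Prop) (c : R -> C) : Prop :=
  continuous_on unit_interval c /\
  (forall s, unit_interval s -> Omega (c s)) /\ c 0 = c 1.

Definition null_homotopic_in (Omega : C -> Prop) (c : R -> C) : Prop :=
  exists H : R * R -> C,
    continuous_on unit_square H /\
    (forall p, unit_square p -> Omega (H p)) /\
    (forall s, unit_interval s -> H (s, 0) = c s /\ H (s, 1) = c 0) /\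
    (forall t, unit_interval t -> H (0, t) = c 0 /\ H (1, t) = c 0).

Definition simply_connected_domain (Omega : C -> Prop) : Prop :=
  domain Omega /\ forall c, loop_in Omega c -> null_homotopic_in Omega c.

Definition holomorphic_on (D : C -> Prop) (f : C -> C) : Prop :=
  forall z, D z -> ex_derive f z.

(* [f] is a biholomorphism from the disc onto [Omega] and [g] is its inverse;
   the values of [f] off the disc and of [g] off [Omega] are irrelevant. *)
Definition riemann_map (Omega : C -> Prop) (f g : C -> C) : Prop :=
  holomorphic_on disc f /\ holomorphic_on Omega g /\
  (forall z, disc z -> Omega (f z) /\ g (f z) = z) /\
  (forall w, Omega w -> disc (g w) /\ f (g w) = w).

(* In what follows the hyperbolic geometry of [Omega] is transported from the
   disc by a Riemann map [f] with inverse [g]. *)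

Definition hyp_norm (f g : C -> C) (z v : C) : R :=
  disc_norm (g z) (v / C_derive f (g z))%C.

Definition hyp_dist (g : C -> C) (z w : C) : R := disc_dist (g z) (g w).

Definition velocity (gamma : R -> C) (t : R) : C :=
  (Derive (fun s => fst (gamma s)) t, Derive (fun s => snd (gamma s)) t).

Definition C1_curve (gamma : R -> C) : Prop :=
  forall t, ex_derive gamma t /\ continuous (velocity gamma) t.

Definition hyp_length (f g : C -> C) (gamma : R -> C) (s t : R) : R :=
  RInt (fun r => hyp_norm f g (gamma r) (velocity gamma r)) s t.

(* "Smooth" is read as continuously differentiable. *)
Definition geodesic
    (Omega : C -> Prop) (f g : C -> C) (gamma : R -> C) : Prop :=
  C1_curve gamma /\ (forall t, Omega (gamma t)) /\
  forall s t, s <= t ->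
    hyp_length f g gamma s t = hyp_dist g (gamma s) (gamma t).

Definition arc_length_parameterized (f g : C -> C) (gamma : R -> C) : Prop :=
  forall s t, s <= t -> hyp_length f g gamma s t = t - s.

Definition on_curve (gamma : R -> C) (p : C) : Prop :=
  exists t, p = gamma t.

Definition closest_point (g : C -> C) (gamma : R -> C) (z p : C) : Prop :=
  on_curve gamma p /\ forall t, hyp_dist g p z <= hyp_dist g (gamma t) z.

(* The choice is constrained by [unique], so it is meaningful only when there
   is exactly one closest point. *)
Definition hyp_proj (g : C -> C) (gamma : R -> C) (z : C) : C :=
  epsilon (inhabits (RtoC 0)) (unique (closest_point g gamma z)).

Definition hyp_dist_to_curve (g : C -> C) (z : C) (gamma : R -> C) : R :=
  real (Glb_Rbar (fun d => exists t, d = hyp_dist g z (gamma t))).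

(* Main.v *)
From Stdlib Require Import Reals Lra ClassicalEpsilon.
From Coquelicot Require Import Coquelicot.
(* Imported last so that [disc] is the unit disc and not [Rtopology.disc]. *)
Require Import Defs.
Open Scope R_scope.

(** The Riemann map turns the statement into one about the disc: there
    [c = g o gamma] satisfies [disc_dist (c s) (c t) = |t - s|], and nothing
    else about [gamma] matters.  The disc is lifted to the hyperboloid
    [B(X, X) = 1] of Minkowski space, where [B(X, Y)] is the hyperbolic cosine
    of twice the distance ([cosh_disc_dist]).

    Any three points of [c] have the Gram matrix of three points on a hyperbola,
    and a null vector orthogonal to a timelike one vanishes, so the lift of [c]
    lies in a plane.  Hence [F t = cosh (2 * disc_dist (c t) w)] is a combination
    of [sinh (2 - 2 t)] and [sinh (2 t)] ([cosh_dist_line]), that is, of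
    [exp (2 t)] and [exp (- 2 t)].  As [F >= 1], both
    exponentials have positive coefficients, so they balance at some time [t0],
    which gives the hyperbolic Pythagorean theorem
    [F t = F t0 * cosh (2 (t - t0))] ([pythagoras_line]).
    Its unique minimum [t0] is the projection, and with
    [a = disc_dist (c t) (c t0)], [b = disc_dist (c t0) w] and
    [d = disc_dist (c t) w] it says [cosh (2 d) = cosh (2 a) * cosh (2 b)].
    Both inequalities follow from this identity and the nonnegativity of
    distances ([right_triangle_le], [right_triangle_ge]); in particular the triangle inequality is not needed. *)

(** * Hyperbolic functions *)

Lemma cosh_opp (x : R) : cosh (- x) = cosh x.
Proof. unfold cosh; rewrite Ropp_involutive; lra. Qed.

Lemma cosh_pos (x : R) : 0 < cosh x.
Proof.
  unfold cosh; pose proof (exp_pos x); pose proof (exp_pos (- x)); lra.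
Qed.

Lemma sinh_minus (x y : R) :
  sinh (x - y) = sinh x * cosh y - cosh x * sinh y.
Proof.
  unfold sinh, cosh; replace (- (x - y)) with (- x + y) by ring.
  unfold Rminus; rewrite !exp_plus; field.
Qed.

Lemma cosh_minus (x y : R) :
  cosh (x - y) = cosh x * cosh y - sinh x * sinh y.
Proof.
  unfold sinh, cosh; replace (- (x - y)) with (- x + y) by ring.
  unfold Rminus; rewrite !exp_plus; field.
Qed.

Lemma cosh_plus (x y : R) :
  cosh (x + y) = cosh x * cosh y + sinh x * sinh y.
Proof.
  unfold sinh, cosh; rewrite Ropp_plus_distr, !exp_plus; field.
Qed.

Lemma cosh_sqr (x : R) : cosh x * cosh x - sinh x * sinh x = 1.
Proof. rewrite <- cosh_minus, Rminus_diag; apply cosh_0. Qed.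

Lemma sinh_nonneg (x : R) : 0 <= x -> 0 <= sinh x.
Proof.
  intros [Hx | <-]; [| rewrite sinh_0; lra].
  rewrite <- sinh_0; left; apply sinh_lt; exact Hx.
Qed.

Lemma cosh_lt (x y : R) : 0 <= x -> x < y -> cosh x < cosh y.
Proof.
  intros Hx Hxy.
  assert (Hs : sinh x < sinh y) by (apply sinh_lt; exact Hxy).
  pose proof (sinh_nonneg x Hx).
  pose proof (cosh_sqr x); pose proof (cosh_sqr y).
  pose proof (cosh_pos x); pose proof (cosh_pos y).
  nra.
Qed.

Lemma cosh_le_inv (x y : R) : 0 <= y -> cosh x <= cosh y -> x <= y.
Proof.
  intros Hy H; destruct (Rle_lt_dec x y) as [h | h]; [exact h |].
  pose proof (cosh_lt y x Hy h); lra.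
Qed.

Lemma cosh_ge_1 (x : R) : 1 <= cosh x.
Proof.
  pose proof (cosh_sqr x); pose proof (cosh_pos x); nra.
Qed.

Lemma cosh_gt_1 (x : R) : x <> 0 -> 1 < cosh x.
Proof.
  intros Hx; rewrite <- cosh_0.
  destruct (Rle_lt_dec 0 x).
  - apply cosh_lt; lra.
  - rewrite <- (cosh_opp x); apply cosh_lt; lra.
Qed.

(** * Right hyperbolic triangles *)

(** In the next two lemmas [a] and [b] are the legs and [d] is the hypotenuse. *)

Lemma right_triangle_le (a b d : R) :
  0 <= a -> 0 <= b ->
  cosh (2 * d) = cosh (2 * a) * cosh (2 * b) -> d <= a + b.
Proof.
  intros Ha Hb H.
  assert (2 * d <= 2 * a + 2 * b); [| lra].
  apply cosh_le_inv; [lra |].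
  rewrite cosh_plus, H.
  assert (0 <= sinh (2 * a)) by (apply sinh_nonneg; lra).
  assert (0 <= sinh (2 * b)) by (apply sinh_nonneg; lra).
  nra.
Qed.

Lemma right_triangle_ge (a b d : R) :
  0 <= d ->
  cosh (2 * d) = cosh (2 * a) * cosh (2 * b) -> a + b - / 2 * ln 2 <= d.
Proof.
  intros Hd H.
  (* When [a + b] is at most [ln 2 / 2] the left-hand side is not positive. *)
  destruct (Rle_lt_dec (2 * (a + b)) (ln 2)) as [h | h]; [lra |].
  assert (2 * (a + b) - ln 2 <= 2 * d); [| lra].
  apply cosh_le_inv; [lra |].
  (* [cosh (2 d)] is the mean of [cosh (2 a + 2 b)] and [cosh (2 a - 2 b)], and
     the second term is at least 1. *)
  pose proof (cosh_plus (2 * a) (2 * b)) as Hp.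
  pose proof (cosh_minus (2 * a) (2 * b)) as Hm.
  pose proof (cosh_ge_1 (2 * a - 2 * b)) as H1.
  assert (He : 2 < exp (2 * (a + b))).
  { rewrite <- (exp_ln 2) at 1 by lra; apply exp_increasing; exact h. }
  replace (2 * a + 2 * b) with (2 * (a + b)) in Hp by ring.
  assert (Hc : cosh (2 * (a + b) - ln 2)
     = exp (2 * (a + b)) / 4 + / exp (2 * (a + b))).
  { unfold cosh.
    replace (- (2 * (a + b) - ln 2)) with (- (2 * (a + b)) + ln 2) by ring.
    unfold Rminus; rewrite !exp_plus, !exp_Ropp, exp_ln by lra.
    field; apply Rgt_not_eq, exp_pos. }
  assert (Hc' : cosh (2 * (a + b))
     = (exp (2 * (a + b)) + / exp (2 * (a + b))) / 2).
  { unfold cosh; rewrite exp_Ropp; reflexivity. }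
  assert (/ exp (2 * (a + b)) < / 2) by (apply Rinv_lt_contravar; lra).
  lra.
Qed.

(** * The hyperboloid model *)

(** The Lorentzian form on three-space, of signature [(+, -, -)]. *)
Definition minkowski (p q : R * R * R) : R :=
  let '(p0, p1, p2) := p in
  let '(q0, q1, q2) := q in
  p0 * q0 - p1 * q1 - p2 * q2.

(** The linear combination [a p + b q + c r]. *)
Definition comb3 (a : R) (p : R * R * R) (b : R) (q : R * R * R)
    (c : R) (r : R * R * R) : R * R * R :=
  let '(p0, p1, p2) := p in
  let '(q0, q1, q2) := q in
  let '(r0, r1, r2) := r in
  (a * p0 + b * q0 + c * r0, a * p1 + b * q1 + c * r1,
   a * p2 + b * q2 + c * r2).

Lemma minkowski_comb3 (a b c : R) (p q r s : R * R * R) :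
  minkowski (comb3 a p b q c r) s
  = a * minkowski p s + b * minkowski q s + c * minkowski r s.
Proof.
  destruct p as [[p0 p1] p2], q as [[q0 q1] q2], r as [[r0 r1] r2],
    s as [[s0 s1] s2]; simpl; ring.
Qed.

Lemma minkowski_sym (p q : R * R * R) : minkowski p q = minkowski q p.
Proof. destruct p as [[p0 p1] p2], q as [[q0 q1] q2]; simpl; ring. Qed.

(** The orthogonal complement of a timelike vector is negative definite. *)
Lemma null_orthogonal_timelike (y p : R * R * R) :
  minkowski p p = 1 -> minkowski y p = 0 -> minkowski y y = 0 ->
  y = (0, 0, 0).
Proof.
  destruct y as [[y0 y1] y2], p as [[p0 p1] p2]; simpl; intros Hp Hyp Hyy.
  assert (CS : (y1 * p1 + y2 * p2) ^ 2
               <= (y1 * y1 + y2 * y2) * (p1 * p1 + p2 * p2)).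
  { pose proof (pow2_ge_0 (y1 * p2 - y2 * p1)); nra. }
  replace (y1 * p1 + y2 * p2) with (y0 * p0) in CS by lra.
  replace (y1 * y1 + y2 * y2) with (y0 * y0) in CS by lra.
  replace (p1 * p1 + p2 * p2) with (p0 * p0 - 1) in CS by lra.
  assert (y0 = 0) by nra; subst y0.
  assert (y1 = 0) by nra; subst y1.
  assert (y2 = 0) by nra; subst y2.
  reflexivity.
Qed.

(** The lift of a point of the disc to the hyperboloid
    [minkowski p p = 1]. *)
Definition lift (z : C) : R * R * R :=
  let n := 1 - (fst z * fst z + snd z * snd z) in
  ((2 - n) / n, 2 * fst z / n, 2 * snd z / n).

Lemma Cmod_sqr (z : C) :
  Cmod z * Cmod z = fst z * fst z + snd z * snd z.
Proof.
  unfold Cmod; rewrite sqrt_sqrt; [ring |].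
  pose proof (pow2_ge_0 (fst z)); pose proof (pow2_ge_0 (snd z)); lra.
Qed.

Lemma disc_sqr_lt_1 (z : C) :
  disc z -> fst z * fst z + snd z * snd z < 1.
Proof.
  unfold disc; intros Hz; rewrite <- Cmod_sqr.
  pose proof (Cmod_ge_0 z); nra.
Qed.

Lemma minkowski_lift_self (z : C) :
  disc z -> minkowski (lift z) (lift z) = 1.
Proof.
  intros Hz; apply disc_sqr_lt_1 in Hz.
  destruct z as [x y]; simpl in *; field; lra.
Qed.

Lemma one_minus_conj_mul_neq_0 (z w : C) :
  disc z -> disc w -> (1 - Cconj z * w)%C <> 0%C.
Proof.
  unfold disc; intros Hz Hw H.
  assert (E : Cmod (Cconj z * w) = 1).
  { replace (Cconj z * w)%C with (1 - (1 - Cconj z * w))%C by ring.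
    rewrite H; replace (1 - 0)%C with (RtoC 1) by ring; apply Cmod_1. }
  rewrite Cmod_mult, Cmod_conj in E.
  pose proof (Cmod_ge_0 z); pose proof (Cmod_ge_0 w); nra.
Qed.

Lemma Cmod_disc_mobius_sqr (z w : C) :
  disc z -> disc w ->
  Cmod (disc_mobius z w) * Cmod (disc_mobius z w)
  = (Cmod (z - w) * Cmod (z - w))
    / (Cmod (1 - Cconj z * w) * Cmod (1 - Cconj z * w)).
Proof.
  intros Hz Hw.
  pose proof (one_minus_conj_mul_neq_0 z w Hz Hw) as Hn.
  unfold disc_mobius; rewrite Cmod_div by exact Hn.
  field; apply Rgt_not_eq, Cmod_gt_0, Hn.
Qed.

Lemma one_minus_conj_mul_sqr (z w : C) :
  Cmod (1 - Cconj z * w) * Cmod (1 - Cconj z * w)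
  = Cmod (z - w) * Cmod (z - w)
    + (1 - (fst z * fst z + snd z * snd z))
      * (1 - (fst w * fst w + snd w * snd w)).
Proof.
  rewrite !Cmod_sqr; destruct z as [x y], w as [u v]; simpl; ring.
Qed.

Lemma Cmod_disc_mobius_lt_1 (z w : C) :
  disc z -> disc w -> Cmod (disc_mobius z w) < 1.
Proof.
  intros Hz Hw.
  pose proof (Cmod_disc_mobius_sqr z w Hz Hw) as E.
  rewrite one_minus_conj_mul_sqr in E.
  apply disc_sqr_lt_1 in Hz; apply disc_sqr_lt_1 in Hw.
  set (m := Cmod (z - w) * Cmod (z - w)) in *.
  set (n := (1 - _) * _) in *.
  assert (0 <= m) by (unfold m; nra).
  assert (0 < n) by (unfold n; apply Rmult_lt_0_compat; lra).
  assert (m / (m + n) < 1) by (apply Rlt_div_l; lra).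
  pose proof (Cmod_ge_0 (disc_mobius z w)); nra.
Qed.

Lemma disc_dist_nonneg (z w : C) :
  disc z -> disc w -> 0 <= disc_dist z w.
Proof.
  intros Hz Hw; unfold disc_dist.
  pose proof (Cmod_disc_mobius_lt_1 z w Hz Hw).
  pose proof (Cmod_ge_0 (disc_mobius z w)).
  set (T := Cmod (disc_mobius z w)) in *.
  assert (1 <= (1 + T) / (1 - T)) by (apply Rle_div_r; lra).
  assert (0 <= ln ((1 + T) / (1 - T))); [| lra].
  rewrite <- ln_1; apply ln_le; lra.
Qed.

Lemma cosh_disc_dist (z w : C) :
  disc z -> disc w ->
  cosh (2 * disc_dist z w) = minkowski (lift z) (lift w).
Proof.
  intros Hz Hw; unfold disc_dist.
  pose proof (Cmod_disc_mobius_lt_1 z w Hz Hw) as HT.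
  pose proof (Cmod_ge_0 (disc_mobius z w)) as HT0.
  pose proof (Cmod_disc_mobius_sqr z w Hz Hw) as E.
  rewrite one_minus_conj_mul_sqr, (Cmod_sqr (z - w)) in E.
  pose proof (disc_sqr_lt_1 z Hz) as Hz'.
  pose proof (disc_sqr_lt_1 w Hw) as Hw'.
  set (T := Cmod (disc_mobius z w)) in *.
  transitivity ((1 + T * T) / (1 - T * T)).
  { unfold cosh; rewrite exp_Ropp.
    replace (2 * (/ 2 * ln ((1 + T) / (1 - T))))
      with (ln ((1 + T) / (1 - T))) by field.
    rewrite exp_ln by (apply Rdiv_lt_0_compat; lra).
    field; repeat split; nra. }
  rewrite E; clearbody T; clear E HT HT0 T Hz Hw.
  destruct z as [x y], w as [u v]; simpl in *.
  assert (0 < (1 - (x * x + y * y)) * (1 - (u * u + v * v)))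
    by (apply Rmult_lt_0_compat; lra).
  pose proof (pow2_ge_0 (x - u)); pose proof (pow2_ge_0 (y - v)).
  field; repeat split; try lra; nra.
Qed.

Lemma disc_dist_sym (z w : C) :
  disc z -> disc w -> disc_dist z w = disc_dist w z.
Proof.
  intros Hz Hw.
  assert (E : cosh (2 * disc_dist z w) = cosh (2 * disc_dist w z)).
  { rewrite !cosh_disc_dist by assumption; apply minkowski_sym. }
  pose proof (disc_dist_nonneg z w Hz Hw).
  pose proof (disc_dist_nonneg w z Hw Hz).
  assert (2 * disc_dist z w <= 2 * disc_dist w z)
    by (apply cosh_le_inv; lra).
  assert (2 * disc_dist w z <= 2 * disc_dist z w)
    by (apply cosh_le_inv; lra).
  lra.
Qed.

(** * Projection onto a geodesic line of the disc *)

(** A geodesic line of the disc parameterized by arc length, as an isometric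
    embedding of the real line. *)
Definition geodesic_line (c : R -> C) : Prop :=
  (forall t, disc (c t)) /\
  forall s t, s <= t -> disc_dist (c s) (c t) = t - s.

Lemma cosh_geodesic_line (c : R -> C) (s t : R) :
  geodesic_line c ->
  minkowski (lift (c s)) (lift (c t)) = cosh (2 * t - 2 * s).
Proof.
  intros [Hd Hc]; rewrite <- cosh_disc_dist by apply Hd.
  destruct (Rle_lt_dec s t) as [h | h].
  - rewrite Hc by exact h; f_equal; ring.
  - rewrite disc_dist_sym, Hc by (apply Hd || lra).
    rewrite <- cosh_opp; f_equal; ring.
Qed.

(** The lift of a geodesic line lies in the plane spanned by its points at times
    0 and 1. *)
Lemma cosh_dist_line (c : R -> C) (w : C) (t : R) :
  geodesic_line c -> disc w ->
  sinh 2 * cosh (2 * disc_dist (c t) w)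
  = sinh (2 - 2 * t) * cosh (2 * disc_dist (c 0) w)
    + sinh (2 * t) * cosh (2 * disc_dist (c 1) w).
Proof.
  intros Hc Hw.
  rewrite !cosh_disc_dist by (apply Hc || exact Hw).
  set (P := lift (c 0)); set (Q := lift (c 1)); set (S := lift (c t)).
  set (Y := comb3 (sinh 2) S (- sinh (2 - 2 * t)) P (- sinh (2 * t)) Q).
  assert (C2 := cosh_sqr 2); assert (Ct := cosh_sqr (2 * t)).
  assert (Hdot : forall a b, minkowski (lift (c a)) (lift (c b))
                             = cosh (2 * b - 2 * a))
    by (intros; apply cosh_geodesic_line, Hc).
  assert (HPP : minkowski P P = 1)
    by (unfold P; apply minkowski_lift_self, Hc).
  assert (HQQ : minkowski Q Q = 1)
    by (unfold Q; apply minkowski_lift_self, Hc).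
  assert (HSS : minkowski S S = 1)
    by (unfold S; apply minkowski_lift_self, Hc).
  assert (HPQ : minkowski P Q = cosh 2)
    by (unfold P, Q; rewrite Hdot; f_equal; ring).
  assert (HPS : minkowski P S = cosh (2 * t))
    by (unfold P, S; rewrite Hdot; f_equal; ring).
  assert (HSQ : minkowski S Q = cosh (2 - 2 * t))
    by (unfold S, Q; rewrite Hdot; f_equal; ring).
  assert (YP : minkowski Y P = 0).
  { unfold Y; rewrite minkowski_comb3.
    rewrite (minkowski_sym S P), (minkowski_sym Q P), HPP, HPQ, HPS.
    rewrite sinh_minus; ring. }
  assert (YQ : minkowski Y Q = 0).
  { unfold Y; rewrite minkowski_comb3, HSQ, HPQ, HQQ.
    rewrite sinh_minus, cosh_minus.
    transitivity ((cosh 2 * cosh 2 - sinh 2 * sinh 2 - 1) * sinh (2 * t));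
      [ring | rewrite C2; ring]. }
  assert (YS : minkowski Y S = 0).
  { unfold Y; rewrite minkowski_comb3, (minkowski_sym Q S), HSQ, HPS, HSS.
    rewrite sinh_minus, cosh_minus.
    transitivity
      (sinh 2 * (1 - (cosh (2 * t) * cosh (2 * t)
                      - sinh (2 * t) * sinh (2 * t))));
      [ring | rewrite Ct; ring]. }
  assert (YY : minkowski Y Y = 0).
  { unfold Y at 1; rewrite minkowski_comb3.
    rewrite !(minkowski_sym _ Y), YP, YQ, YS; ring. }
  assert (HY : minkowski Y (lift w) = 0).
  { rewrite (null_orthogonal_timelike Y P HPP YP YY).
    destruct (lift w) as [[w0 w1] w2]; simpl; ring. }
  unfold Y in HY; rewrite minkowski_comb3 in HY; lra.
Qed.

(** If [a <= 0], the combination tends to a nonpositive limit or to minus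
    infinity as [t] grows. *)
Lemma exp_comb_pos (a b : R) :
  (forall t, 1 <= a * exp (2 * t) + b * exp (- (2 * t))) -> 0 < a.
Proof.
  intros H; destruct (Rlt_le_dec 0 a) as [h | h]; [exact h | exfalso].
  (* At this [t] the second term is at most [|b| / (|b| + 1)]. *)
  set (t := ln (Rabs b + 1) / 2).
  pose proof (Rabs_pos b); pose proof (Rle_abs b).
  specialize (H t).
  assert (E : exp (2 * t) = Rabs b + 1).
  { unfold t; replace (2 * (ln (Rabs b + 1) / 2))
      with (ln (Rabs b + 1)) by field.
    apply exp_ln; lra. }
  rewrite exp_Ropp, E in H.
  assert (b * / (Rabs b + 1) < 1) by (apply Rlt_div_l; lra).
  nra.
Qed.

Lemma pythagoras_line (c : R -> C) (w : C) :
  geodesic_line c -> disc w ->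
  exists t0, forall t,
    cosh (2 * disc_dist (c t) w)
    = cosh (2 * disc_dist (c t0) w) * cosh (2 * (t - t0)).
Proof.
  intros Hc Hw.
  pose proof (fun t => cosh_dist_line c w t Hc Hw) as HF.
  set (F0 := cosh (2 * disc_dist (c 0) w)) in *.
  set (F1 := cosh (2 * disc_dist (c 1) w)) in *.
  assert (Hs : 0 < sinh 2) by (rewrite <- sinh_0; apply sinh_lt; lra).
  (* The coefficients of [exp (2 t)] and [exp (- 2 t)]. *)
  set (a := (F1 - exp (- (2)) * F0) / (2 * sinh 2)).
  set (b := (exp 2 * F0 - F1) / (2 * sinh 2)).
  assert (HE : forall t, cosh (2 * disc_dist (c t) w)
                         = a * exp (2 * t) + b * exp (- (2 * t))).
  { intros t; apply (Rmult_eq_reg_l (sinh 2)); [| lra].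
    rewrite HF; unfold a, b.
    replace (sinh 2 * ((F1 - exp (- (2)) * F0) / (2 * sinh 2) * exp (2 * t)
               + (exp 2 * F0 - F1) / (2 * sinh 2) * exp (- (2 * t))))
      with ((F1 - exp (- (2)) * F0) / 2 * exp (2 * t)
            + (exp 2 * F0 - F1) / 2 * exp (- (2 * t))) by (field; lra).
    unfold sinh; replace (- (2 - 2 * t)) with (- (2) + 2 * t) by ring.
    unfold Rminus; rewrite !exp_plus; field. }
  assert (Ha : 0 < a).
  { apply (exp_comb_pos a b); intros t; rewrite <- HE; apply cosh_ge_1. }
  assert (Hb : 0 < b).
  { apply (exp_comb_pos b a); intros t.
    pose proof (HE (- t)) as E; pose proof (cosh_ge_1 (2 * disc_dist (c (- t)) w)).
    replace (2 * - t) with (- (2 * t)) in E by ring.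
    rewrite Ropp_involutive in E; lra. }
  (* The two terms are equal at [t0]. *)
  exists (ln (b / a) / 4); set (t0 := ln (b / a) / 4); intros t.
  assert (E0 : a * exp (2 * t0) = b * exp (- (2 * t0))).
  { assert (Eq : exp (2 * t0) * exp (2 * t0) = b / a).
    { rewrite <- exp_plus; unfold t0.
      replace (2 * (ln (b / a) / 4) + 2 * (ln (b / a) / 4))
        with (ln (b / a)) by field.
      apply exp_ln, Rdiv_lt_0_compat; assumption. }
    rewrite exp_Ropp; pose proof (exp_pos (2 * t0)).
    apply (Rmult_eq_reg_r (exp (2 * t0))); [| lra].
    rewrite Rmult_assoc, Eq; field; lra. }
  rewrite !HE, <- E0; unfold cosh.
  replace (exp (2 * t)) with (exp (2 * t0) * exp (2 * (t - t0)))
    by (rewrite <- exp_plus; f_equal; ring).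
  replace (exp (- (2 * t))) with (exp (- (2 * t0)) * exp (- (2 * (t - t0))))
    by (rewrite <- exp_plus; f_equal; ring).
  transitivity (a * exp (2 * t0) * exp (2 * (t - t0))
                + b * exp (- (2 * t0)) * exp (- (2 * (t - t0)))); [ring |].
  rewrite <- E0; field.
Qed.

(** The foot [t0] of the perpendicular is the strict minimum of the distance. *)
Lemma pythagoras_line_lt (c : R -> C) (w : C) (t0 t : R) :
  geodesic_line c -> disc w ->
  cosh (2 * disc_dist (c t) w)
    = cosh (2 * disc_dist (c t0) w) * cosh (2 * (t - t0)) ->
  t <> t0 -> disc_dist (c t0) w < disc_dist (c t) w.
Proof.
  intros Hc Hw E Ht.
  assert (H1 : 1 < cosh (2 * (t - t0))) by (apply cosh_gt_1; lra).
  pose proof (cosh_ge_1 (2 * disc_dist (c t0) w)).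
  pose proof (disc_dist_nonneg (c t0) w (proj1 Hc t0) Hw).
  destruct (Rlt_le_dec (disc_dist (c t0) w) (disc_dist (c t) w))
    as [h | h]; [exact h | exfalso].
  assert (cosh (2 * disc_dist (c t) w) <= cosh (2 * disc_dist (c t0) w)).
  { destruct h as [h | h]; [| rewrite h; lra].
    left; apply cosh_lt; [| lra].
    pose proof (disc_dist_nonneg (c t) w (proj1 Hc t) Hw); lra. }
  nra.
Qed.

Theorem proposition3p4 :
  forall (Omega : C -> Prop) (f g : C -> C) (gamma : R -> C) (x0 z : C),
    simply_connected_domain Omega ->
    (exists w, ~ Omega w) ->
    riemann_map Omega f g ->
    geodesic Omega f g gamma ->
    arc_length_parameterized f g gamma ->
    on_curve gamma x0 ->
    Omega z ->
    hyp_dist_to_curve g z gamma = hyp_dist g z (hyp_proj g gamma z) /\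
    hyp_dist g x0 (hyp_proj g gamma z) + hyp_dist_to_curve g z gamma
      - / 2 * ln 2 <= hyp_dist g x0 z /\
    hyp_dist g x0 z <=
      hyp_dist g x0 (hyp_proj g gamma z) + hyp_dist_to_curve g z gamma.
Proof.
  intros Omega f g gamma x0 z _ _ [_ [_ [_ Hg]]] [_ [Hin Hgeo]] Harc [t ->] Hz.
  set (c := fun t => g (gamma t)).
  assert (Hc : geodesic_line c).
  { split; [intros s; apply Hg, Hin |].
    intros s s' Hs; rewrite <- (Harc s s' Hs); symmetry; exact (Hgeo s s' Hs). }
  assert (Hw : disc (g z)) by apply Hg, Hz.
  destruct (pythagoras_line c (g z) Hc Hw) as [t0 Ht0].
  assert (Hlt : forall s, s <> t0 ->
             disc_dist (c t0) (g z) < disc_dist (c s) (g z))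
    by (intros s; apply pythagoras_line_lt; auto).
  assert (Hle : forall s, disc_dist (c t0) (g z) <= disc_dist (c s) (g z)).
  { intros s; destruct (Req_dec s t0) as [-> | Hs];
      [apply Rle_refl | left; apply Hlt, Hs]. }
  assert (Hu : unique (closest_point g gamma z) (gamma t0)).
  { split; [split; [exists t0; reflexivity | exact Hle] |].
    intros p [[s ->] Hs]; destruct (Req_dec s t0) as [-> | Hst]; [reflexivity |].
    pose proof (Hlt s Hst); specialize (Hs t0); unfold hyp_dist, c in *; lra. }
  assert (Hproj : hyp_proj g gamma z = gamma t0).
  { assert (Hu' : unique (closest_point g gamma z) (hyp_proj g gamma z))
      by (unfold hyp_proj; apply epsilon_spec; exists (gamma t0); exact Hu).
    apply Hu', Hu. }
  assert (Hsym : forall s, hyp_dist g z (gamma s) = disc_dist (c s) (g z))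
    by (intros s; apply disc_dist_sym; [exact Hw | apply Hc]).
  assert (Hd : hyp_dist_to_curve g z gamma = disc_dist (c t0) (g z)).
  { unfold hyp_dist_to_curve.
    rewrite (is_glb_Rbar_unique _ (Finite (disc_dist (c t0) (g z))));
      [reflexivity |].
    split.
    - intros d [s ->]; simpl; rewrite Hsym; apply Hle.
    - intros m Hm; apply (Hm (disc_dist (c t0) (g z))).
      exists t0; symmetry; apply Hsym. }
  assert (Hx : cosh (2 * hyp_dist g (gamma t) (gamma t0))
               = cosh (2 * (t - t0))).
  { change (hyp_dist g (gamma t) (gamma t0)) with (disc_dist (c t) (c t0)).
    rewrite cosh_disc_dist, cosh_geodesic_line by (apply Hc || exact Hc).
    rewrite <- cosh_opp; f_equal; ring. }
  assert (Htri : cosh (2 * hyp_dist g (gamma t) z)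
            = cosh (2 * hyp_dist g (gamma t) (gamma t0))
              * cosh (2 * disc_dist (c t0) (g z))).
  { rewrite Hx, (Rmult_comm (cosh (2 * (t - t0)))); exact (Ht0 t). }
  rewrite Hproj, Hd; split; [symmetry; apply Hsym |]; split.
  - apply right_triangle_ge; [apply disc_dist_nonneg; auto; apply Hc | exact Htri].
  - apply right_triangle_le; [| | exact Htri];
      apply disc_dist_nonneg; auto; apply Hc.
Qed.
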